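(* Suppose that the climatological distribution $G\in\mathcal{P}$ is continuous, and let $q'_{i,j}$ denote the $(i,j)$th entry of the $\mathrm{LEPS}_{\mathrm c}$ scoring matrix for ordinal categories $(C_1,\ldots,C_N)$, i.e. $q'_{i,j}=\mathrm{LEPS}_{\mathrm c}(C_i,C_j)$. Then $$q'_{i,i}=2\bigl(P_i^2+P_{i-1}P_i+P_{i-1}^2-2P_i-P_{i-1}+1\bigr),\qquad 1\le i\le N,$$ $$q'_{i,j}=2-3(P_{i-1}+P_i)+3P_{i-1}P_i+3P_{j-1}P_j+(P_i-P_{i-1})^2+(P_j-P_{j-1})^2,\qquad 1\le j<i\le N,$$ $$q'_{i,j}=q'_{j,i},\qquad 1\le i<j\le N.$$ Moreover, $\mathrm{LEPS}_{\mathrm c}$ is equitable with respect to $G$ with equitability constant $0$.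
   Context: $\mathcal{P}$ is the class of Borel probability measures on $\mathbb{R}$ (with mass concentrated in the outcome interval $I$; here $I=\mathbb{R}$), identified with their CDFs. The outcome space is partitioned into $N$ ordinal categories $C_1,\ldots,C_N$, which are disjoint consecutive intervals in increasing order, each having positive climatological probability $p_i=\mathbb{P}_G(Y\in C_i)>0$. $P_i=\sum_{k=1}^i p_k$ is the cumulative climatological probability of categories $C_1$ through $C_i$, and $P_0=0$. For real $x,y$, $$\mathrm{LEPS}_{\mathrm r}(x,y)=3\bigl(1-|G(x)-G(y)|+G(x)^2-G(x)+G(y)^2-G(y)\bigr)-1.$$ For continuous $G$, $\mathrm{LEPS}_{\mathrm c}:\{C_1,\ldots,C_N\}\times\{C_1,\ldots,C_N\}\to\mathbb{R}$ is defined by $$\mathrm{LEPS}_{\mathrm c}(C_i,C_j)=\mathbb{E}[\mathrm{LEPS}_{\mathrm r}(X,Y)\mid X\sim G,\ Y\sim G,\ X\in C_i,\ Y\in C_j],$$ where $X$ and $Y$ are independent. Equitability of $\mathrm{LEPS}_{\mathrm c}$ with respect to $G$ with equitability constant $c$ means that $\sum_{j=1}^N p_j\,\mathrm{LEPS}_{\mathrm c}(C_i,C_j)=c$ for every $1\le i\le N$. *)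

(* Defs.v *)
From HB Require Import structures.
From mathcomp Require Import all_boot all_order all_algebra.
From mathcomp Require Import all_classical all_reals all_analysis.

Set Implicit Arguments.
Unset Strict Implicit.
Unset Printing Implicit Defensive.

Import Order.TTheory GRing.Theory Num.Theory.
Import numFieldNormedType.Exports.

Local Open Scope classical_set_scope.
Local Open Scope ring_scope.

Definition CDF (R : realType) (G : probability (measurableTypeR R) R) (x : R)
  : R := fine (G `]-oo, x]%classic).

(* Conditional expectation of f given the event A, E[f 1_A] / P(A); only
   meaningful when P(A) > 0 and f is integrable on A. *)
Definition cond_expectation (d : measure_display) (T : measurableType d)
    (R : realType) (P : {measure set T -> \bar R}) (f : T -> R) (A : set T) : R :=
  (\int[P]_(w in A) f w) / fine (P A).

(* C 0, ..., C (N - 1) are the categories C_1, ..., C_N: category i + 1 has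
   index i : 'I_N.  Endpoints may be attached to either side. *)
Definition ordinal_categories (R : realType) (N : nat) (C : 'I_N -> set R)
  : Prop :=
  [/\ partition [set: 'I_N] C [set: R],
      forall i : 'I_N, is_interval (C i)
    & forall (i j : 'I_N) (x y : R), (i < j)%N -> C i x -> C j y -> x < y].

Section Scores.
Variables (R : realType) (G : probability (measurableTypeR R) R).

Definition clim_prob (N : nat) (C : 'I_N -> set R) (i : 'I_N) : R :=
  fine (G (C i)).

(* P_k, the total probability of the first k categories; P_0 = 0. *)
Definition cum_clim_prob (N : nat) (C : 'I_N -> set R) (k : nat) : R :=
  \sum_(i < N | (i < k)%N) clim_prob C i.

Definition LEPSr (x y : R) : R :=
  let g := CDF G in
  3 * (1 - `|g x - g y| + g x ^+ 2 - g x + g y ^+ 2 - g y) - 1.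

(* The pair (X, Y) of independent variables with law G is taken to be the
   coordinate pair z on R * R under the product measure. *)
Definition LEPSc (A B : set R) : R :=
  cond_expectation (G \x G)%E (fun z => LEPSr z.1 z.2) (A `*` B).

Definition LEPSc_matrix (N : nat) (C : 'I_N -> set R) : 'M[R]_N :=
  \matrix_(i, j) LEPSc (C i) (C j).

Definition equitable (N : nat) (C : 'I_N -> set R) (S : set R -> set R -> R)
    (c : R) : Prop :=
  forall i : 'I_N, \sum_(j < N) clim_prob C j * S (C i) (C j) = c.

End Scores.

(* Main.v *)
Require Import Defs.
From HB Require Import structures.
From mathcomp Require Import all_boot all_order all_algebra.
From mathcomp Require Import all_classical all_reals all_analysis.
From mathcomp Require Import measurable_realfun.
From mathcomp Require Import ring lra.

Set Implicit Arguments.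
Unset Strict Implicit.
Unset Printing Implicit Defensive.

Import Order.TTheory GRing.Theory Num.Theory.
Import numFieldNormedType.Exports.

Local Open Scope classical_set_scope.
Local Open Scope ring_scope.

(** Write [g] for the CDF of [G].  Since [g] is continuous, [g X] is uniform on
[[0, 1]] when [X] has law [G] ([pushforward_CDF]).  A category [C i] differs
from [g @^-1` `[P i, P i.+1]] by a [G]-null set, so that integrating a
continuous function of [g X] over [C i] amounts to integrating that function
over [`[P i, P i.+1]] against the Lebesgue measure ([slice_category],
[Rintegral_comp_CDF]).

As [LEPSr] depends on its arguments only through [g], Fubini's theorem turns
the score of two categories into an iterated integral of
[3 * (1 - `|s - v| + s ^+ 2 - s + v ^+ 2 - v) - 1] over a rectangle, divided
by the area of that rectangle ([LEPScE]).  Off the diagonal, [s - v] has a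
constant sign and the integrand is a polynomial ([LEPSc_offdiag]); on the
diagonal the inner integral is split at [v = s] ([LEPSc_diag]).

Equitability then follows from the closed formulas by a telescoping sum
([equitable_telescope]). *)

(** * Continuous distribution functions *)

Section CDF_theory.
Variables (R : realType) (G : probability (measurableTypeR R) R).
Local Notation g := (CDF G).

Lemma CDFE x : (g x)%:E = G `]-oo, x]%classic.
Proof. by rewrite /CDF fineK// fin_num_measure. Qed.

Lemma CDF_ge0 x : 0 <= g x.
Proof. by rewrite fine_ge0. Qed.

Lemma CDF_le1 x : g x <= 1.
Proof. by rewrite -lee_fin CDFE probability_le1. Qed.

Lemma CDF_nondecreasing : {homo g : x y / x <= y}.
Proof.
by move=> x y xy; rewrite -lee_fin !CDFE le_measure ?inE//; exact: subset_itvl.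
Qed.

Lemma measurable_CDF (D : set R) : measurable D -> measurable_fun D g.
Proof.
by move=> mD; apply: nondecreasing_measurable => //; exact: CDF_nondecreasing.
Qed.

Lemma measurable_CDF_le u :
  measurable ([set x | g x <= u] : set (measurableTypeR R)).
Proof.
rewrite (_ : [set x | _] = setT `&` g @^-1` `]-oo, u]%classic); last first.
  by apply/seteqP; split => x; rewrite /= in_itv/= => // -[].
exact: measurable_CDF.
Qed.

Let idR : measurableTypeR R -> R := idfun.

#[local] HB.instance Definition _ :=
  @isMeasurableFun.Build _ _ _ _ idR (@measurable_id _ _ setT).

Lemma CDF_cvgy : g @ +oo --> (1 : R).
Proof. exact/fine_cvg/(@cvg_cdfy1 _ _ _ G (idR : {RV G >-> R})). Qed.

Lemma CDF_cvgNy : g @ -oo --> (0 : R).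
Proof. exact/fine_cvg/(@cvg_cdfNy0 _ _ _ G (idR : {RV G >-> R})). Qed.

Hypothesis g_cont : continuous g.

Lemma CDF_surj v : 0 < v < 1 -> exists x, g x = v.
Proof.
move=> /andP[v0 v1].
have [x gx] : exists x, g x < v.
  exact: filter_ex (cvgr_lt _ CDF_cvgNy _ v0).
have [y gy] : exists y, v < g y.
  exact: filter_ex (cvgr_gt _ CDF_cvgy _ v1).
have xy : x <= y.
  by rewrite leNgt; apply/negP => /ltW/CDF_nondecreasing; lra.
have [| |c _ <-] := @IVT R g x y v xy; last by exists c.
- exact: continuous_subspaceT.
- by rewrite ge_min le_max (ltW gx) (ltW gy) orbT.
Qed.

(** No strict monotonicity is assumed: the sublevel set is squeezed between rays
whose endpoints have levels arbitrarily close to [u]. *)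
Lemma measure_CDF_le u : 0 <= u <= 1 -> G [set x | g x <= u] = u%:E.
Proof.
move=> /andP[u0 u1]; set S := [set x | _].
have mS : measurable S := measurable_CDF_le u.
rewrite -[LHS]fineK ?fin_num_measure//; congr EFin.
have m0 : 0 <= fine (G S) by exact: fine_ge0.
have m1 : fine (G S) <= 1.
  by rewrite -lee_fin fineK ?fin_num_measure// probability_le1.
(* A strict inequality either way leaves room for a ray whose mass is the
   midpoint of [u] and [G S]. *)
apply/eqP; rewrite eq_le; apply/andP; split; rewrite leNgt; apply/negP => um.
- have [|x gx] := @CDF_surj ((u + fine (G S)) / 2).
    by apply/andP; split; lra.
  have : fine (G S) <= g x; last by rewrite gx; lra.
  rewrite -lee_fin CDFE fineK ?fin_num_measure// le_measure ?inE// => y.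
  rewrite /S/= => gy.
  by rewrite in_itv/= leNgt; apply/negP => /ltW/CDF_nondecreasing; lra.
- have [|x gx] := @CDF_surj ((u + fine (G S)) / 2).
    by apply/andP; split; lra.
  have : g x <= fine (G S); last by rewrite gx; lra.
  rewrite -lee_fin CDFE fineK ?fin_num_measure// le_measure ?inE// => y /=.
  by rewrite in_itv/= => /CDF_nondecreasing; rewrite /S/=; lra.
Qed.

Let gT : measurableTypeR R -> measurableTypeR R := g.

#[local] HB.instance Definition _ :=
  @isMeasurableFun.Build _ _ _ _ gT (measurable_CDF measurableT).

(** The probability integral transform: if [X] has law [G], then [g X] is
uniform on [[0, 1]].  The two measures are compared on the rays
[`]u, +oo[]. *)
Lemma pushforward_CDF (A : set R) : measurable A ->
  G (g @^-1` A) = lebesgue_measure (A `&` `[0, 1]%classic).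
Proof.
move=> mA.
pose m1 : probability (measurableTypeR R) R :=
  distribution G (gT : {mfun measurableTypeR R >-> measurableTypeR R}).
pose m2 : {measure set (measurableTypeR R) -> \bar R} :=
  mrestr (@lebesgue_measure R) (measurable_itv `[0 : R, 1]).
rewrite -[LHS]/(m1 A) -[RHS]/(m2 A).
apply: (@measure_unique _ R (measurableTypeR R) (@RGenOInfty.G R)
  (fun k : nat => `]- k%:R, +oo[%classic) (RGenOInfty.measurableE R)
  _ _ _ m1 m2) => //.
- move=> _ _ [x ->] [y ->]; exists (Num.max x y).
  apply/seteqP; split => z /=; rewrite !in_itv/= !andbT gt_max.
    by move=> [-> ->].
  by move=> /andP.
- by move=> i; exists (- i%:R).
- rewrite -subTset => x _; exists (Num.bound `|x|) => //=.
  have := archi_boundP (normr_ge0 x); rewrite in_itv/= andbT.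
  by rewrite ltr_norml => /andP[].
- move=> _ [u ->]; rewrite /m1 /m2/= /distribution /pushforward /mrestr/=.
  have [u0|u0] := ltP u 0.
    rewrite (_ : gT @^-1` _ = setT); last first.
      rewrite -subTset => x _ /=; rewrite in_itv/= andbT.
      by rewrite (lt_le_trans u0) ?CDF_ge0.
    rewrite (_ : _ `&` _ = `[0, 1]%classic); last first.
      apply/setIidr => x /=; rewrite !in_itv/= andbT => /andP[x0 _].
      exact: lt_le_trans x0.
    by rewrite probability_setT lebesgue_measure_itv/= lte_fin ltr01 oppr0 adde0.
  have [u1|u1] := leP u 1; last first.
    rewrite (_ : gT @^-1` _ = set0); last first.
      rewrite -subset0 => x /=; rewrite in_itv/= andbT ltNge.
      by rewrite (le_trans (CDF_le1 x) (ltW u1)).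
    rewrite (_ : _ `&` _ = set0) ?measure0//.
    rewrite -subset0 => x [/=]; rewrite !in_itv/= andbT => ux /andP[_ x1]; lra.
  rewrite (_ : gT @^-1` _ = ~` [set x | g x <= u]); last first.
    by apply/seteqP; split => x /=; rewrite in_itv/= andbT ltNge => /negP.
  rewrite probability_setC; last exact: measurable_CDF_le.
  rewrite [X in (_ - X)%E]measure_CDF_le ?u0//.
  rewrite (_ : _ `&` _ = `]u, 1]%classic); last first.
    apply/seteqP; split => x /=; rewrite !in_itv/= andbT.
      by move=> [-> /andP[_ ->]].
    by move=> /andP[ux x1]; split; rewrite ?x1 ?andbT//; lra.
  rewrite lebesgue_measure_itv/= lte_fin; case: ltP => //.
  by move=> uge1; rewrite (_ : u = 1) ?subee//; lra.
- by move=> k; rewrite (le_lt_trans (@probability_le1 _ _ _ m1 _ _))// ?ltry.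
Qed.

End CDF_theory.

(** * Integration of functions of the CDF *)

(** The fundamental theorem of calculus for a polynomial [F]; the interval may
be degenerate. *)
Lemma Rintegral_deriv (R : realType) (F : {poly R}) (a b : R) : a <= b ->
  \int[lebesgue_measure]_(v in `[a, b]) F^`().[v] = F.[b] - F.[a].
Proof.
rewrite le_eqVlt => /predU1P[<-|ab].
  by rewrite set_itv1 Rintegral_set1 subrr.
rewrite /Rintegral (@continuous_FTC2 _ (horner F^`()) (horner F))//.
- exact/continuous_subspaceT/continuous_horner.
- split=> [x _| |]; first exact: derivable_horner.
  + exact/cvg_at_right_filter/continuous_horner.
  + exact/cvg_at_left_filter/continuous_horner.
- by move=> x _; rewrite derivE.
Qed.

(** Fubini's theorem on a rectangle for real-valued integrals.  The sections are
required to be integrable for all [x] in [A], and not just almost all, so that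
the inner real-valued integral agrees everywhere with the extended one. *)
Lemma Rintegral_prodE d1 d2 (T1 : measurableType d1) (T2 : measurableType d2)
    (R : realType) (m1 : {sigma_finite_measure set T1 -> \bar R})
    (m2 : {sigma_finite_measure set T2 -> \bar R}) (f : T1 * T2 -> R)
    (A : set T1) (B : set T2) :
  measurable A -> measurable B ->
  (m1 \x m2)%E.-integrable (A `*` B) (EFin \o f) ->
  (forall x, A x -> m2.-integrable B (fun y => (f (x, y))%:E)) ->
  \int[(m1 \x m2)%E]_(z in A `*` B) f z =
  \int[m1]_(x in A) \int[m2]_(y in B) f (x, y).
Proof.
move=> mA mB fi fxi; rewrite /Rintegral; congr fine.
rewrite integral_mkcond -integral12_prod_meas1/=; last first.
  by apply/integrable_restrict; rewrite ?setTI//; exact: measurableX.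
rewrite [RHS]integral_mkcond; apply: eq_integral => x _.
rewrite /fubini_F [RHS]patchE; case: ifPn => xA.
  rewrite fineK; last by apply: integrable_fin_num => //; exact/fxi/set_mem.
  rewrite [RHS]integral_mkcond; apply: eq_integral => y _; rewrite !patchE.
  by rewrite in_setX/= xA.
by rewrite integral0_eq// => y _; rewrite patchE in_setX/= (negbTE xA).
Qed.

Section slices.
Variables (R : realType) (G : probability (measurableTypeR R) R).
Local Notation g := (CDF G).

(** [slice A a b] says that [A] carries all the mass of [G] between the levels
[a] and [b] of [g]: the levels of the points of [A] lie in [`[a, b]], and [A]
has mass [b - a], which is that of [g @^-1` `[a, b]] when [g] is continuous. *)
Definition slice (A : set R) (a b : R) : Prop :=
  [/\ measurable A, 0 <= a /\ b <= 1, a <= b,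
      forall x, A x -> a <= g x <= b & G A = (b - a)%:E].

Lemma integrable_comp_CDF (A : set R) (f : R -> R) :
  measurable A -> continuous f -> G.-integrable A (EFin \o (f \o g)).
Proof.
move=> mA fc; apply: (@measurable_bounded_integrable _ (measurableTypeR R)) => //.
- by rewrite (le_lt_trans (probability_le1 _ _))// ?ltry.
- apply: measurableT_comp; first exact: continuous_measurable_fun.
  exact: measurable_CDF.
- have /compact_bounded[M [Mr Mb]] : compact (f @` `[0, 1]).
    apply: continuous_compact; last exact: segment_compact.
    exact: continuous_subspaceT.
  exists M; split => // r Mr' x Ax /=; apply: (Mb _ Mr').
  by exists (g x) => //=; rewrite in_itv/= CDF_ge0 CDF_le1.
Qed.

Hypothesis g_cont : continuous g.

Lemma Rintegral_comp_CDF (A : set R) a b (f : R -> R) :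
  slice A a b -> continuous f ->
  \int[G]_(x in A) f (g x) = \int[lebesgue_measure]_(v in `[a, b]) f v.
Proof.
move=> [mA [a0 b1] ab Aab GA] fc.
pose B := g @^-1` `[a, b].
have mB : measurable (B : set (measurableTypeR R)).
  by rewrite -[B]setTI; exact: measurable_CDF.
have sub01 : `[a, b] `<=` `[0, 1].
  by move=> v /=; rewrite !in_itv/= => /andP[? ?]; apply/andP; split; lra.
have AB : A `<=` B by move=> x /Aab; rewrite /B/= in_itv.
have GBA : G (B `\` A) = 0%E.
  rewrite measureD ?setIidr//; last by rewrite -ge0_fin_numE// fin_num_measure.
  rewrite [X in (X - _)%E]pushforward_CDF// setIidl// [X in (_ - X)%E]GA.
  by rewrite lebesgue_measure_itv/= lte_fin; case: ltP => [_|ba];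
    rewrite ?subee// (_ : b - a = 0) ?sube0//; lra.
rewrite /Rintegral; congr fine.
(* [A] and [B] differ by a null set, and [B] is a preimage under [g]. *)
transitivity (\int[G]_(x in B) (f (g x))%:E)%E.
  rewrite [RHS](@negligible_integral _ (measurableTypeR R) _ _ _ (B `\` A))//.
  - by rewrite setDD setIidr.
  - exact: measurableD.
  - exact: integrable_comp_CDF.
rewrite -[LHS](@integral_pushforward _ _ (measurableTypeR R)
  (measurableTypeR R) R g (measurable_CDF G measurableT) G _ (EFin \o f))//.
- apply: eq_measure_integral => [|? E mE Eab]; first exact: measurable_CDF.
  transitivity (lebesgue_measure (E `&` `[0, 1])); first exact: pushforward_CDF.
  by rewrite setIidl//; exact: subset_trans sub01.
- by apply/measurable_EFinP; exact: continuous_measurable_fun.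
- exact: integrable_comp_CDF.
Qed.

End slices.

(** * The LEPS score in terms of the levels *)

Definition poly_derivE := (derivD, derivN, derivM, derivC, derivXn, derivX).

Definition poly_evalE :=
  (hornerD, hornerN, hornerM, hornerMn, hornerC, hornerX, hornerXn).

Section leps.
Variable R : realType.
Implicit Types a b c d e s v : R.

(** The score [LEPSr] as a function of the levels [s = g x] and [v = g y]; this
is the LEPS score of the uniform distribution on [[0, 1]]. *)
Definition leps_uniform s v : R :=
  3 * (1 - `|s - v| + s ^+ 2 - s + v ^+ 2 - v) - 1.

Lemma continuous_leps_uniform s : continuous (leps_uniform s).
Proof.
move=> v; rewrite /leps_uniform.
apply: cvgB; last exact: cvg_cst.
apply: cvgMl_tmp.
apply: cvgB; last exact: cvg_id.
apply: cvgD; last by rewrite expr2; apply: cvgM; exact: cvg_id.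
apply: cvgB; last exact: cvg_cst.
apply: cvgD; last exact: cvg_cst.
apply: cvgB; first exact: cvg_cst.
apply: cvg_norm; apply: cvgB; [exact: cvg_cst|exact: cvg_id].
Qed.

(** The inner integral when [s] lies on one side of [`[c, d]]: [e] is
the sign of [s - v], that is [1] if [d <= s] and [-1] if [s <= c]. *)
Lemma Rintegral_leps_sign e c d s : c <= d ->
  (forall v, c <= v <= d -> `|s - v| = e * (s - v)) ->
  \int[lebesgue_measure]_(v in `[c, d]) leps_uniform s v =
  d ^+ 3 - c ^+ 3 + 3 * (e - 1) / 2 * (d ^+ 2 - c ^+ 2)
  + (2 - 3 * e * s + 3 * s ^+ 2 - 3 * s) * (d - c).
Proof.
move=> cd sv.
pose F : {poly R} := 'X^3 + (3 * (e - 1) / 2)%:P * 'X^2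
  + (2 - 3 * e * s + 3 * s ^+ 2 - 3 * s)%:P * 'X.
transitivity (F.[d] - F.[c]); last by rewrite /F !poly_evalE; ring.
rewrite -Rintegral_deriv//; apply: eq_Rintegral => v.
rewrite inE/= in_itv/= => /sv; rewrite /leps_uniform => ->.
by rewrite /F !poly_derivE !poly_evalE/=; field.
Qed.

(** The inner integral when [s] lies in [`[c, d]], split at [v = s]. *)
Lemma Rintegral_leps_mid c d s : c <= s <= d ->
  \int[lebesgue_measure]_(v in `[c, d]) leps_uniform s v =
  3 * (d - c - 1) * s ^+ 2 + 6 * c * s
  + (d ^+ 3 - c ^+ 3 - 3 * d ^+ 2 + 2 * (d - c)).
Proof.
move=> /andP[cs sd].
have int u w : lebesgue_measure.-integrable `[u, w] (EFin \o leps_uniform s).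
  apply: continuous_compact_integrable; first exact: segment_compact.
  exact/continuous_subspaceT/continuous_leps_uniform.
have := @Rintegral_itvB R (leps_uniform s) (BLeft c) (BRight d) s (int c d).
rewrite !bnd_simp => /(_ cs sd) /eqP; rewrite subr_eq => /eqP ->.
rewrite Rintegral_itv_obnd_cbnd; last first.
  by apply: integrableS (int s d) => //; exact: subset_itv_oc_cc.
rewrite (@Rintegral_leps_sign 1 c s)//; last first.
  by move=> v /andP[_ vs]; rewrite mul1r ger0_norm// subr_ge0.
rewrite (@Rintegral_leps_sign (-1) s d)//; last first.
  by move=> v /andP[sv _]; rewrite mulN1r ler0_norm// subr_le0.
by field.
Qed.

End leps.

Section LEPSc_slices.
Variables (R : realType) (G : probability (measurableTypeR R) R).
Hypothesis g_cont : continuous (CDF G).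
Local Notation g := (CDF G).
Implicit Types (A B : set R) (a b c d : R).

(** Conditional expectation over a product of slices, after Fubini's theorem and
the change of variable [v = g y]; the outer change of variable [s = g x] is left
to [Rintegral_slice]. *)
Lemma LEPScE A B a b c d : slice G A a b -> slice G B c d ->
  LEPSc G A B =
  (\int[G]_(x in A) \int[lebesgue_measure]_(v in `[c, d]) leps_uniform (g x) v)
  / ((b - a) * (d - c)).
Proof.
move=> SA SB; have [mA _ _ _ GA] := SA; have [mB _ _ _ GB] := SB.
rewrite /LEPSc /cond_expectation; congr (_ / _); last first.
  rewrite [X in fine X](_ : _ = (G A * G B)%E); last exact: product_measure1E.
  by rewrite GA GB.
rewrite Rintegral_prodE//.
- apply: eq_Rintegral => x _.
  exact: (Rintegral_comp_CDF g_cont SB (@continuous_leps_uniform _ (g x))).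
- apply: measurable_bounded_integrable.
  + exact: measurableX.
  + rewrite [X in (X < _)%E](_ : _ = (G A * G B)%E); last exact: product_measure1E.
    by rewrite GA GB -EFinM ltry.
  + apply: measurable_funTS; rewrite /LEPSr.
    have m1 : measurable_fun [set: measurableTypeR R * measurableTypeR R]
        (fun z => g z.1).
      by apply: measurableT_comp => //; exact: measurable_CDF.
    have m2 : measurable_fun [set: measurableTypeR R * measurableTypeR R]
        (fun z => g z.2).
      by apply: measurableT_comp => //; exact: measurable_CDF.
    apply: measurable_funB => //; apply: measurable_funM => //.
    apply: measurable_funB => //; apply: measurable_funD => //;
      last exact: measurable_funX.
    apply: measurable_funB => //; apply: measurable_funD => //;
      last exact: measurable_funX.
    apply: measurable_funB => //; apply: measurableT_comp => //.
    exact: measurable_funB.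
  (* Since the levels lie in [[0, 1]], [10] is a crude bound on the score. *)
  + exists 10; split => // M M10 [x y] _; rewrite /LEPSr/=.
    have := CDF_ge0 G x; have := CDF_le1 G x.
    have := CDF_ge0 G y; have := CDF_le1 G y.
    move: (g x) (g y) => s v v1 v0 s1 s0.
    rewrite (le_trans _ (ltW M10))// ler_norml.
    have s2 : 0 <= s ^+ 2 <= s by rewrite sqr_ge0 expr2 ler_piMl.
    have v2 : 0 <= v ^+ 2 <= v by rewrite sqr_ge0 expr2 ler_piMl.
    have sv : `|s - v| <= 1 by rewrite ler_norml; apply/andP; split; lra.
    by have sv0 := normr_ge0 (s - v); apply/andP; split; lra.
- move=> x _.
  exact: (integrable_comp_CDF G mB (@continuous_leps_uniform _ (g x))).
Qed.

Lemma Rintegral_slice A a b (F : {poly R}) (f : R -> R) : slice G A a b ->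
  (forall x, A x -> f x = F^`().[g x]) ->
  \int[G]_(x in A) f x = F.[b] - F.[a].
Proof.
move=> SA fF; have [_ _ ab _ _] := SA.
rewrite -Rintegral_deriv//.
rewrite -(Rintegral_comp_CDF g_cont SA (@continuous_horner _ F^`())).
by apply: eq_Rintegral => x /set_mem /fF.
Qed.

Lemma LEPSc_diag A a b : slice G A a b -> a < b ->
  LEPSc G A A = 2 * (b ^+ 2 + a * b + a ^+ 2 - 2 * b - a + 1).
Proof.
move=> SA ab; have [_ _ _ Aab _] := SA; rewrite (LEPScE SA SA).
pose F : {poly R} := (b - a - 1)%:P * 'X^3 + (3 * a)%:P * 'X^2
  + (b ^+ 3 - a ^+ 3 - 3 * b ^+ 2 + 2 * (b - a))%:P * 'X.
rewrite (Rintegral_slice (F := F) SA).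
  by rewrite /F !poly_evalE/=; field; rewrite subr_eq0 gt_eqF.
move=> x /Aab; move/Rintegral_leps_mid ->.
by rewrite /F !poly_derivE !poly_evalE/=; ring.
Qed.

(** As in [Rintegral_leps_sign], [e] is [1] when [A] lies above [B], and [-1]
when it lies below. *)
Lemma LEPSc_offdiag e A B a b c d :
  slice G A a b -> slice G B c d -> a < b -> c < d ->
  (forall s v, a <= s <= b -> c <= v <= d -> `|s - v| = e * (s - v)) ->
  LEPSc G A B = 2 + (a ^+ 2 + a * b + b ^+ 2) + (c ^+ 2 + c * d + d ^+ 2)
    - 3 * (1 + e) / 2 * (a + b) - 3 * (1 - e) / 2 * (c + d).
Proof.
move=> SA SB ab cd abcd; have [_ _ _ Aab _] := SA; rewrite (LEPScE SA SB).
pose F : {poly R} := (d - c)%:P * 'X^3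
  - (3 * (1 + e) / 2 * (d - c))%:P * 'X^2
  + (d ^+ 3 - c ^+ 3 + 3 * (e - 1) / 2 * (d ^+ 2 - c ^+ 2) + 2 * (d - c))%:P
    * 'X.
rewrite (Rintegral_slice (F := F) SA).
  by rewrite /F !poly_evalE/=; field; rewrite !subr_eq0 !gt_eqF.
move=> x /Aab gx; rewrite (@Rintegral_leps_sign _ e)//.
- by rewrite /F !poly_derivE !poly_evalE/=; field.
- exact: ltW.
- by move=> v; exact: abcd.
Qed.

End LEPSc_slices.

(** * Ordinal categories and equitability *)

Section categories.
Variables (R : realType) (G : probability (measurableTypeR R) R).
Variables (N : nat) (C : 'I_N -> set R).
Hypothesis C_categories : ordinal_categories C.
Local Notation g := (CDF G).
Local Notation P := (cum_clim_prob G C).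

Lemma measurable_category i : measurable (C i : set (measurableTypeR R)).
Proof. by apply: is_interval_measurable; case: C_categories. Qed.

Lemma cum_clim_probE k :
  (P k)%:E = G (\bigcup_(i in [set i : 'I_N | (i < k)%N]) C i).
Proof.
rewrite bigcup_pred measure_bigsetU_ord_cond.
- rewrite /cum_clim_prob -sumEFin; apply: eq_bigr => i _.
  by rewrite fineK// fin_num_measure//; exact: measurable_category.
- by move=> i _; exact: measurable_category.
- have [[_ tC _] _ _] := C_categories.
  by move=> i j _ _; exact: tC.
Qed.

Lemma measurable_categories (D : set 'I_N) :
  measurable (\bigcup_(i in D) C i : set (measurableTypeR R)).
Proof.
apply: fin_bigcup_measurable => //.
by move=> i _; exact: measurable_category.
Qed.

Lemma cum_clim_prob_ge0 k : 0 <= P k.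
Proof. by rewrite -lee_fin cum_clim_probE. Qed.

Lemma cum_clim_prob_le1 k : P k <= 1.
Proof.
rewrite -lee_fin cum_clim_probE probability_le1//.
exact: measurable_categories.
Qed.

Lemma cum_clim_prob0 : P 0 = 0.
Proof. by rewrite /cum_clim_prob big_pred0. Qed.

Lemma cum_clim_probS (i : 'I_N) : P i.+1 = P i + clim_prob G C i.
Proof.
rewrite /cum_clim_prob (bigD1 i)//= addrC; congr (_ + _); apply: eq_bigl => j.
by rewrite ltnS ltn_neqAle andbC.
Qed.

Lemma cum_clim_prob_all : P N = 1.
Proof.
have [[cC _ _] _ _] := C_categories; apply: EFin_inj.
rewrite cum_clim_probE (_ : [set i | _] = setT) -?/(cover _ _).
  by rewrite cC probability_setT.
by apply/seteqP; split => i //= _; exact: ltn_ord.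
Qed.

(** For [x] in [C i], the ray [`]-oo, x]] contains the categories below [C i],
and is contained in the union of these with [C i]. *)
Lemma slice_category i : slice G (C i) (P i) (P i.+1).
Proof.
have [[cC _ _] _ ltC] := C_categories.
split.
- exact: measurable_category.
- by rewrite cum_clim_prob_ge0 cum_clim_prob_le1.
- by rewrite cum_clim_probS lerDl fine_ge0.
- move=> x Cx; rewrite -!lee_fin CDFE !cum_clim_probE.
  apply/andP; split; apply: le_measure; rewrite ?inE//;
    try exact: measurable_categories.
  + move=> y [j /= ji Cy]; rewrite in_itv/= ltW//; exact: ltC ji Cy Cx.
  + move=> y /=; rewrite in_itv/= => yx.
    have [j _ Cy] : cover setT C y by rewrite cC.
    exists j => //=; rewrite ltnS leqNgt; apply/negP => ij.
    by have := ltC _ _ _ _ ij Cx Cy; rewrite ltNge yx.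
- rewrite cum_clim_probS addrAC subrr add0r fineK//.
  by rewrite fin_num_measure//; exact: measurable_category.
Qed.

End categories.

(** Row [i] of the scoring matrix, weighted by the category probabilities, sums
to zero.  The [j]-th term is the increment at [j] of an explicit function [F] of
the cumulative probability, given by one expression up to index [i] and by another
one after it, and [F] vanishes at both ends. *)
Lemma equitable_telescope (R : realFieldType) (N : nat) (P : nat -> R)
    (q : 'M[R]_N) :
  P 0%N = 0 -> P N = 1 ->
  (forall i : 'I_N, q i i = 2 * (P i.+1 ^+ 2 + P i * P i.+1 + P i ^+ 2
                          - 2 * P i.+1 - P i + 1)) ->
  (forall i j : 'I_N, (j < i)%N ->
    q i j = 2 - 3 * (P i + P i.+1) + 3 * P i * P i.+1 + 3 * P j * P j.+1
            + (P i.+1 - P i) ^+ 2 + (P j.+1 - P j) ^+ 2) ->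
  (forall i j : 'I_N, (i < j)%N -> q i j = q j i) ->
  forall i : 'I_N, \sum_(j < N) (P j.+1 - P j) * q i j = 0.
Proof.
move=> P0 PN qd ql qs i.
pose a := P i; pose b := P i.+1; pose S := a ^+ 2 + a * b + b ^+ 2.
(* The constant [S] in the second expression makes the increment at [j = i],
   where the expression changes, the right one. *)
pose F k := P k ^+ 3 + (2 + S) * P k
  - (if (k <= i)%N then 3 * (a + b) * P k else 3 * P k ^+ 2 + S).
transitivity (\sum_(0 <= j < N) (F j.+1 - F j)).
  rewrite big_mkord; apply: eq_bigr => j _; rewrite /F.
  case: (ltngtP j i) => [ji|ij|/val_inj ->].
  - by rewrite ql// /S /a /b; ring.
  - by rewrite qs// ql// /S /a /b; ring.
  - by rewrite qd /S /a /b; ring.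
rewrite telescope_sumr// /F leq0n P0 PN leqNgt ltn_ord/= /S; ring.
Qed.

Theorem proposition5 (R : realType) (G : probability (measurableTypeR R) R)
    (N : nat) (C : 'I_N -> set R)
    (G_continuous : continuous (CDF G))
    (C_categories : ordinal_categories C)
    (p_gt0 : forall i : 'I_N, 0 < clim_prob G C i) :
  let P := cum_clim_prob G C in
  let q' := LEPSc_matrix G C in
  [/\ forall i : 'I_N,
        q' i i = 2 * (P i.+1 ^+ 2 + P i * P i.+1 + P i ^+ 2
                      - 2 * P i.+1 - P i + 1),
      forall i j : 'I_N, (j < i)%N ->
        q' i j = 2 - 3 * (P i + P i.+1) + 3 * P i * P i.+1
                 + 3 * P j * P j.+1
                 + (P i.+1 - P i) ^+ 2 + (P j.+1 - P j) ^+ 2,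
      forall i j : 'I_N, (i < j)%N -> q' i j = q' j i
    & equitable G C (LEPSc G) 0].
Proof.
move=> P q'.
have Cs (i : 'I_N) : slice G (C i) (P i) (P i.+1) by exact: slice_category.
have Plt (i : 'I_N) : P i < P i.+1 by rewrite /P cum_clim_probS// ltrDl.
have Pmono (i j : 'I_N) : (i < j)%N -> P i.+1 <= P j.
  move=> ij; rewrite /P /cum_clim_prob [leRHS]big_mkcond [leLHS]big_mkcond/=.
  apply: ler_sum => k _; case: ifPn => ki; last by case: ifP => // _; exact: ltW.
  by rewrite (leq_ltn_trans _ ij).
have qd (i : 'I_N) : q' i i = 2 * (P i.+1 ^+ 2 + P i * P i.+1 + P i ^+ 2
                          - 2 * P i.+1 - P i + 1).
  by rewrite mxE (LEPSc_diag G_continuous (Cs i)).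
have ql (i j : 'I_N) : (j < i)%N ->
    q' i j = 2 - 3 * (P i + P i.+1) + 3 * P i * P i.+1
             + 3 * P j * P j.+1
             + (P i.+1 - P i) ^+ 2 + (P j.+1 - P j) ^+ 2.
  move=> /Pmono ji; rewrite mxE.
  rewrite (LEPSc_offdiag (e := 1) G_continuous (Cs i) (Cs j))//; first by field.
  move=> s v /andP[si _] /andP[_ vj].
  by rewrite mul1r ger0_norm// subr_ge0 (le_trans vj)// (le_trans ji).
have qs (i j : 'I_N) : (i < j)%N -> q' i j = q' j i.
  move=> ij; rewrite (ql _ _ ij) mxE; have Pij := Pmono _ _ ij.
  rewrite (LEPSc_offdiag (e := -1) G_continuous (Cs i) (Cs j))//; first by field.
  move=> s v /andP[_ si] /andP[vj _].
  by rewrite mulN1r ler0_norm// subr_le0 (le_trans si)// (le_trans Pij).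
split => // i.
rewrite -[RHS](equitable_telescope (cum_clim_prob0 G C)
  (cum_clim_prob_all G C_categories) qd ql qs i).
apply: eq_bigr => j _.
by rewrite mxE cum_clim_probS// addrAC subrr add0r.
Qed.
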